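(* Consider the scenario-oriented energy-reserve co-optimization model (II) described in the context, and assume $\underline G=0$ (the lower output bound of each generator is zero). Let an optimal solution of (II) with associated optimal multipliers be given, and let $(\eta^g(j),\eta^U(j),\eta^D(j))$ be the prices defined in the context. Then, with the realization of any scenario, the total credit of any generator $j$ is no less than its total bid-in cost of energy, reserve, and re-dispatch, i.e. for every generator $j$, at the optimal solution, $$\eta^g(j)g(j)+\eta^U(j)r_U(j)+\eta^D(j)r_D(j)\;\ge\; c_g(j)g(j)+c_U(j)r_U(j)+c_D(j)r_D(j).$$
   Context: Model (II). There are finitely many buses, generators $j$ (located at bus $m_j$), loads $l$ (located at bus $m_l$), and a finite set $\mathcal K$ of mutually exclusive non-base scenarios with given occurrence probabilities $\epsilon_k>0$, $\sum_{k\in\mathcal K}\epsilon_k\le 1$. The setting is single-period, lossless DC power flow; renewables are treated as negative loads; non-base scenarios may contain line outages and load fluctuations but no generator outages. Decision variables: generation $g$, upward reserve $r_U$, downward reserve $r_D$ (vectors over generators), and for each $k\in\mathcal K$ upward/downward re-dispatch $\delta g^U_k,\delta g^D_k$ (over generators) and load shedding $\delta d_k$ (over loads). Data: bid-in prices $c_g,c_U,c_D$, re-dispatch prices $\overline c,\underline c$, load-shedding prices $c_L$, base load $d$, load fluctuation $\pi_k$ (with $d+\pi_k\ge 0$), generation bounds $\underline G,\overline G$, reserve bounds $\overline{r_U},\overline{r_D}$, line limits $f$ (base) and $f_k$ (scenario $k$), shift-factor matrices $S_G,S_D$ (base) and $S_{G,k},S_{D,k}$ (scenario $k$) for generators and loads.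 Model (II) is the linear program $$\min\; F=c_g^Tg+c_U^Tr_U+c_D^Tr_D+\sum_{k\in\mathcal K}\epsilon_k(\overline c^T\delta g^U_k-\underline c^T\delta g^D_k+c_L^T\delta d_k)$$ subject to (multipliers in front) $(\lambda,\mu)$: $\mathbf 1^Tg=\mathbf 1^Td$, $S_Gg-S_Dd\le f$; $(\underline\upsilon,\overline\upsilon)$: $\underline G+r_D\le g$, $g+r_U\le\overline G$; $(\underline{\rho^U},\overline{\rho^U},\underline{\rho^D},\overline{\rho^D})$: $0\le r_U\le\overline{r_U}$, $0\le r_D\le\overline{r_D}$; and for all $k\in\mathcal K$: $\lambda_k$: $\mathbf 1^T(g+\delta g^U_k-\delta g^D_k)=\mathbf 1^T(d+\pi_k-\delta d_k)$; $\mu_k$: $S_{G,k}(g+\delta g^U_k-\delta g^D_k)-S_{D,k}(d+\pi_k-\delta d_k)\le f_k$; $(\underline{\alpha_k},\overline{\alpha_k})$: $0\le\delta g^U_k\le r_U$; $(\underline{\beta_k},\overline{\beta_k})$: $0\le\delta g^D_k\le r_D$; $(\underline{\tau_k},\overline{\tau_k})$: $0\le\delta d_k\le d+\pi_k$. Sign convention: the Lagrangian is $F$ plus $\lambda(\mathbf 1^Td-\mathbf 1^Tg)$, plus $\lambda_k(\mathbf 1^T(d+\pi_k-\delta d_k)-\mathbf 1^T(g+\delta g^U_k-\delta g^D_k))$ for each $k$, plus, for each inequality $a\le b$, its nonnegative multiplier times $(a-b)$. It is assumed that (II) has an optimal solution; superscript $*$ denotes optimal values and multipliers, fixed throughout.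 $S_G(\cdot,m_j)$ and $S_{G,k}(\cdot,m_j)$ denote the columns of $S_G$ and $S_{G,k}$ corresponding to generator $j$ (located at bus $m_j$). Prices of generator $j$: energy $\eta^g(j)=\lambda^*-S_G(\cdot,m_j)^T\mu^*+\sum_{k\in\mathcal K}(\lambda_k^*-S_{G,k}(\cdot,m_j)^T\mu_k^* )$; upward reserve $\eta^U(j)=\sum_{k\in\mathcal K}\overline{\alpha_k}^*(j)$; downward reserve $\eta^D(j)=\sum_{k\in\mathcal K}\overline{\beta_k}^*(j)$. Settlement: ex-ante, generator $j$ receives $\eta^g(j)g(j)+\eta^U(j)r_U(j)+\eta^D(j)r_D(j)$. Ex-post, if non-base scenario $k$ is realized, generator $j$ additionally receives $\overline c(j)\delta g^U_k(j)-\underline c(j)\delta g^D_k(j)$, which equals its bid-in re-dispatch cost in that scenario (re-dispatch is settled as bid), so these terms cancel in the comparison of credit and cost; if the base case is realized there is no ex-post settlement. *)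

(* Defs.v *)
From HB Require Import structures.
From mathcomp Require Import all_boot all_order all_algebra.

Set Implicit Arguments.
Unset Strict Implicit.
Unset Printing Implicit Defensive.

Import Order.TTheory GRing.Theory Num.Theory.
Local Open Scope ring_scope.

Definition dot (R : realFieldType) (n : nat) (u v : 'cV[R]_n) : R :=
  \sum_(i < n) u i 0 * v i 0.

Definition total (R : realFieldType) (n : nat) (v : 'cV[R]_n) : R :=
  \sum_(i < n) v i 0.

Definition lecv (R : realFieldType) (n : nat) (u v : 'cV[R]_n) : Prop :=
  forall i : 'I_n, u i 0 <= v i 0.

(* Column j of SG (resp. SGk k) is the shift-factor column S_G(., m_j) of the
   bus m_j at which generator j is located, and likewise for loads; buses enter
   the model only through these columns.  The number of line constraints may
   depend on the scenario, because of line outages.  cup and cdown are the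
   upward and downward re-dispatch prices; dload k is the fluctuation pi_k. *)
Record model (R : realFieldType) := Model {
  scen : finType;
  ngen : nat;
  nload : nat;
  nline : nat;
  nlinek : scen -> nat;
  eps : scen -> R;
  cg : 'cV[R]_ngen;
  cU : 'cV[R]_ngen;
  cD : 'cV[R]_ngen;
  cup : 'cV[R]_ngen;
  cdown : 'cV[R]_ngen;
  cL : 'cV[R]_nload;
  load : 'cV[R]_nload;
  dload : scen -> 'cV[R]_nload;
  Gmin : 'cV[R]_ngen;
  Gmax : 'cV[R]_ngen;
  rUmax : 'cV[R]_ngen;
  rDmax : 'cV[R]_ngen;
  flim : 'cV[R]_nline;
  flimk : forall k : scen, 'cV[R]_(nlinek k);
  SG : 'M[R]_(nline, ngen);
  SD : 'M[R]_(nline, nload);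
  SGk : forall k : scen, 'M[R]_(nlinek k, ngen);
  SDk : forall k : scen, 'M[R]_(nlinek k, nload);
  eps_gt0 : forall k : scen, 0 < eps k;
  eps_sum_le1 : \sum_(k : scen) eps k <= 1;
  load_ge0 : forall k : scen, lecv 0 (load + dload k)
}.

Arguments nlinek {R} M k : rename.
Arguments eps {R} M k : rename.
Arguments dload {R} M k : rename.
Arguments flimk {R} M k : rename.
Arguments SGk {R} M k : rename.
Arguments SDk {R} M k : rename.
Arguments eps_gt0 {R} M k : rename.
Arguments load_ge0 {R} M k i : rename.

Record decision (R : realFieldType) (M : model R) := Decision {
  gen : 'cV[R]_(ngen M);
  rU : 'cV[R]_(ngen M);
  rD : 'cV[R]_(ngen M);
  dgU : scen M -> 'cV[R]_(ngen M);
  dgD : scen M -> 'cV[R]_(ngen M);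
  shed : scen M -> 'cV[R]_(nload M)
}.

Record multipliers (R : realFieldType) (M : model R) := Multipliers {
  lam : R;
  mu : 'cV[R]_(nline M);
  ups_lo : 'cV[R]_(ngen M);
  ups_up : 'cV[R]_(ngen M);
  rhoU_lo : 'cV[R]_(ngen M);
  rhoU_up : 'cV[R]_(ngen M);
  rhoD_lo : 'cV[R]_(ngen M);
  rhoD_up : 'cV[R]_(ngen M);
  lamk : scen M -> R;
  muk : forall k : scen M, 'cV[R]_(nlinek M k);
  alpha_lo : scen M -> 'cV[R]_(ngen M);
  alpha_up : scen M -> 'cV[R]_(ngen M);
  beta_lo : scen M -> 'cV[R]_(ngen M);
  beta_up : scen M -> 'cV[R]_(ngen M);
  tau_lo : scen M -> 'cV[R]_(nload M);
  tau_up : scen M -> 'cV[R]_(nload M)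
}.

Definition objective (R : realFieldType) (M : model R) (x : decision M) : R :=
  dot (cg M) (gen x) + dot (cU M) (rU x) + dot (cD M) (rD x)
  + \sum_(k : scen M) eps M k *
      (dot (cup M) (dgU x k) - dot (cdown M) (dgD x k) + dot (cL M) (shed x k)).

Definition genk (R : realFieldType) (M : model R) (x : decision M)
    (k : scen M) : 'cV[R]_(ngen M) := gen x + dgU x k - dgD x k.

Definition loadk (R : realFieldType) (M : model R) (x : decision M)
    (k : scen M) : 'cV[R]_(nload M) := load M + dload M k - shed x k.

Definition feasible_base (R : realFieldType) (M : model R) (x : decision M)
    : Prop :=
  [/\ total (gen x) = total (load M),
      lecv (SG M *m gen x - SD M *m load M) (flim M),
      lecv (Gmin M + rD x) (gen x) /\ lecv (gen x + rU x) (Gmax M),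
      lecv 0 (rU x) /\ lecv (rU x) (rUmax M)
    & lecv 0 (rD x) /\ lecv (rD x) (rDmax M)].

Definition feasible_scen (R : realFieldType) (M : model R) (x : decision M)
    (k : scen M) : Prop :=
  [/\ total (genk x k) = total (loadk x k),
      lecv (SGk M k *m genk x k - SDk M k *m loadk x k) (flimk M k),
      lecv 0 (dgU x k) /\ lecv (dgU x k) (rU x),
      lecv 0 (dgD x k) /\ lecv (dgD x k) (rD x)
    & lecv 0 (shed x k) /\ lecv (shed x k) (load M + dload M k)].

Definition feasible (R : realFieldType) (M : model R) (x : decision M) : Prop :=
  feasible_base x /\ forall k : scen M, feasible_scen x k.

Definition optimal (R : realFieldType) (M : model R) (x : decision M) : Prop :=
  feasible x /\
  forall x' : decision M, feasible x' -> objective x <= objective x'.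

Definition lagrangian (R : realFieldType) (M : model R)
    (x : decision M) (y : multipliers M) : R :=
  objective x
  + lam y * (total (load M) - total (gen x))
  + dot (mu y) (SG M *m gen x - SD M *m load M - flim M)
  + dot (ups_lo y) (Gmin M + rD x - gen x)
  + dot (ups_up y) (gen x + rU x - Gmax M)
  + dot (rhoU_lo y) (0 - rU x)
  + dot (rhoU_up y) (rU x - rUmax M)
  + dot (rhoD_lo y) (0 - rD x)
  + dot (rhoD_up y) (rD x - rDmax M)
  + \sum_(k : scen M)
      (lamk y k * (total (loadk x k) - total (genk x k))
       + dot (muk y k)
           (SGk M k *m genk x k - SDk M k *m loadk x k - flimk M k)
       + dot (alpha_lo y k) (0 - dgU x k)
       + dot (alpha_up y k) (dgU x k - rU x)
       + dot (beta_lo y k) (0 - dgD x k)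
       + dot (beta_up y k) (dgD x k - rD x)
       + dot (tau_lo y k) (0 - shed x k)
       + dot (tau_up y k) (shed x k - (load M + dload M k))).

Definition multipliers_ge0 (R : realFieldType) (M : model R)
    (y : multipliers M) : Prop :=
  [/\ lecv 0 (mu y),
      lecv 0 (ups_lo y) /\ lecv 0 (ups_up y),
      lecv 0 (rhoU_lo y) /\ lecv 0 (rhoU_up y),
      lecv 0 (rhoD_lo y) /\ lecv 0 (rhoD_up y)
    & forall k : scen M,
        [/\ lecv 0 (muk y k),
            lecv 0 (alpha_lo y k) /\ lecv 0 (alpha_up y k),
            lecv 0 (beta_lo y k) /\ lecv 0 (beta_up y k)
          & lecv 0 (tau_lo y k) /\ lecv 0 (tau_up y k)]].

(* Lagrange multipliers associated with the optimal solution x: the dual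
   function at y, i.e. the infimum of lagrangian x' y over all unconstrained
   x', is at least, hence by weak duality equal to, the optimal value. *)
Definition optimal_multipliers (R : realFieldType) (M : model R)
    (x : decision M) (y : multipliers M) : Prop :=
  multipliers_ge0 y /\
  forall x' : decision M, objective x <= lagrangian x' y.

Definition price_g (R : realFieldType) (M : model R) (y : multipliers M)
    (j : 'I_(ngen M)) : R :=
  lam y - dot (col j (SG M)) (mu y)
  + \sum_(k : scen M) (lamk y k - dot (col j (SGk M k)) (muk y k)).

Definition price_U (R : realFieldType) (M : model R) (y : multipliers M)
    (j : 'I_(ngen M)) : R := \sum_(k : scen M) alpha_up y k j 0.

Definition price_D (R : realFieldType) (M : model R) (y : multipliers M)
    (j : 'I_(ngen M)) : R := \sum_(k : scen M) beta_up y k j 0.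

(* The realized scenario is None for the base case, Some k for k.  Re-dispatch
   is settled as bid, so this is both the ex-post payment to generator j and
   its bid-in re-dispatch cost. *)
Definition redispatch (R : realFieldType) (M : model R) (x : decision M)
    (s : option (scen M)) (j : 'I_(ngen M)) : R :=
  if s is Some k
  then cup M j 0 * dgU x k j 0 - cdown M j 0 * dgD x k j 0
  else 0.

Definition credit (R : realFieldType) (M : model R) (x : decision M)
    (y : multipliers M) (s : option (scen M)) (j : 'I_(ngen M)) : R :=
  price_g y j * gen x j 0 + price_U y j * rU x j 0 + price_D y j * rD x j 0
  + redispatch x s j.

Definition bid_cost (R : realFieldType) (M : model R) (x : decision M)
    (s : option (scen M)) (j : 'I_(ngen M)) : R :=
  cg M j 0 * gen x j 0 + cU M j 0 * rU x j 0 + cD M j 0 * rD x j 0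
  + redispatch x s j.

(* Main.v *)
(* Removing generator j from the dispatch (g(j), r_U(j), r_D(j) set to 0, the
   rest of the optimal solution kept) gives a point that need not be feasible,
   but the Lagrangian there is still at least the optimal value F^*.  The
   Lagrangian is affine, so this point changes it by credit minus cost of j
   minus multiplier terms of j.  At the optimum the Lagrangian is F^* plus
   nonpositive multiplier-times-slack terms; keeping those of the three lower
   bounds of generator j absorbs, as Gmin = 0, all the multiplier terms of the
   wrong sign. *)
Require Import Defs.
From HB Require Import structures.
From mathcomp Require Import all_boot all_order all_algebra.
From mathcomp Require Import ring lra.

Set Implicit Arguments.
Unset Strict Implicit.
Unset Printing Implicit Defensive.

Import Order.TTheory GRing.Theory Num.Theory.
Local Open Scope ring_scope.

Section Dot.
Variables (R : realFieldType) (n : nat).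
Implicit Types (u v w : 'cV[R]_n) (a : R) (j : 'I_n).

Lemma dotDr u v w : dot u (v + w) = dot u v + dot u w.
Proof. by rewrite /dot -big_split; apply: eq_bigr => i _; rewrite mxE mulrDr. Qed.

Lemma dotZr u a v : dot u (a *: v) = a * dot u v.
Proof. by rewrite /dot mulr_sumr; apply: eq_bigr => i _; rewrite mxE mulrCA. Qed.

Lemma dotNr u v : dot u (- v) = - dot u v.
Proof. by rewrite -scaleN1r dotZr mulN1r. Qed.

Lemma dotC u v : dot u v = dot v u.
Proof. by apply: eq_bigr => i _; rewrite mulrC. Qed.

Lemma dot_delta u j : dot u (delta_mx j 0) = u j 0.
Proof.
rewrite /dot (bigD1 j) //= big1 => [|i /negPf ij]; rewrite !mxE ?ij ?mulr0 //.
by rewrite !eqxx mulr1 addr0.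
Qed.

Lemma total_dot u : Defs.total u = dot (const_mx 1) u.
Proof. by apply: eq_bigr => i _; rewrite mxE mul1r. Qed.

Lemma dot_ge0_le0 u v : lecv 0 u -> lecv v 0 -> dot u v <= 0.
Proof.
move=> u0 v0; apply: sumr_le0 => i _.
by apply: mulr_ge0_le0; [have := u0 i | have := v0 i]; rewrite mxE.
Qed.

(** Every summand is nonpositive, so discarding all but the one at [j] can only increase the
    value. *)
Lemma dot_ge0_le0_coord u v j :
  lecv 0 u -> lecv v 0 -> dot u v <= u j 0 * v j 0.
Proof.
move=> u0 v0; rewrite /dot (bigD1 j) //= gerDl; apply: sumr_le0 => i _.
by apply: mulr_ge0_le0; [have := u0 i | have := v0 i]; rewrite mxE.
Qed.

Lemma lecv_subr_le0 u v : lecv u v -> lecv (u - v) 0.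
Proof. by move=> uv i; rewrite !mxE subr_le0. Qed.

End Dot.

Section Lagrangian.
Variables (R : realFieldType) (M : model R).
Implicit Types (x : decision M) (y : multipliers M) (j : 'I_(ngen M)).

Definition shift_gen x j (a b c : R) : decision M :=
  Decision (gen x + a *: delta_mx j 0) (rU x + b *: delta_mx j 0)
    (rD x + c *: delta_mx j 0) (dgU x) (dgD x) (shed x).

(** The bracketed factors are the partial derivatives of the affine Lagrangian in g(j), r_U(j),
    r_D(j); the terms from balances, line limits and re-dispatch caps are exactly the prices. *)
Lemma lagrangian_shift_gen x y j a b c :
  lagrangian (shift_gen x j a b c) y = lagrangian x y
    + a * (cg M j 0 - price_g y j - ups_lo y j 0 + ups_up y j 0)
    + b * (cU M j 0 - price_U y j + ups_up y j 0 - rhoU_lo y j 0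
           + rhoU_up y j 0)
    + c * (cD M j 0 - price_D y j + ups_lo y j 0 - rhoD_lo y j 0
           + rhoD_up y j 0).
Proof.
rewrite /lagrangian /objective /price_g /price_U /price_D /=.
set S1 := \sum_k (_ + _ + _); set S0 := \sum_k (_ + _ + _).
(* With re-dispatch fixed, a scenario block sees the shift only through [genk] and the caps [rU],
   [rD]. *)
have -> : S1 = S0
    - a * (\sum_(k : scen M) (lamk y k - dot (col j (SGk M k)) (muk y k)))
    - b * (\sum_(k : scen M) alpha_up y k j 0)
    - c * (\sum_(k : scen M) beta_up y k j 0).
  rewrite /S1 /S0 !mulr_sumr -!sumrN -!big_split /=; apply: eq_bigr => k _.
  rewrite /genk /loadk /= !total_dot !mulmxDr -!scalemxAr -colE !mulmxN.
  rewrite !(dotDr, dotNr, dotZr, dot_delta) mxE (dotC (col j _)); ring.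
rewrite !total_dot mulmxDr -scalemxAr -colE.
rewrite !(dotDr, dotNr, dotZr, dot_delta) mxE (dotC (col j _)); ring.
Qed.

(** At a feasible point the balance terms vanish and each multiplier-times-slack product is
    nonpositive; only those of the three lower bounds at [j] are kept. *)
Lemma lagrangian_le_objective x y j :
  feasible x -> multipliers_ge0 y ->
  lagrangian x y <= objective x
    + ups_lo y j 0 * (Gmin M j 0 + rD x j 0 - gen x j 0)
    - rhoU_lo y j 0 * rU x j 0 - rhoD_lo y j 0 * rD x j 0.
Proof.
case=> -[bal line [Glo Gup] [rU0 rUm] [rD0 rDm]] Hs.
case=> mu0 [ul0 uu0] [Ul0 Uu0] [Dl0 Du0] Ys.
rewrite /lagrangian bal subrr mulr0 addr0.
have := dot_ge0_le0 mu0 (lecv_subr_le0 line).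
have := dot_ge0_le0_coord j ul0 (lecv_subr_le0 Glo).
have := dot_ge0_le0 uu0 (lecv_subr_le0 Gup).
have := dot_ge0_le0_coord j Ul0 (lecv_subr_le0 rU0).
have := dot_ge0_le0 Uu0 (lecv_subr_le0 rUm).
have := dot_ge0_le0_coord j Dl0 (lecv_subr_le0 rD0).
have := dot_ge0_le0 Du0 (lecv_subr_le0 rDm).
set S := \sum_k (_ + _ + _ + _ + _ + _ + _ + _).
have : S <= 0.
  apply: sumr_le0 => k _.
  case: (Hs k) => balk linek [gU0 gUm] [gD0 gDm] [s0 sm].
  case: (Ys k) => muk0 [al0 au0] [bl0 bu0] [tl0 tu0].
  rewrite balk subrr mulr0 add0r.
  have := dot_ge0_le0 muk0 (lecv_subr_le0 linek).
  have := dot_ge0_le0 al0 (lecv_subr_le0 gU0).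
  have := dot_ge0_le0 au0 (lecv_subr_le0 gUm).
  have := dot_ge0_le0 bl0 (lecv_subr_le0 gD0).
  have := dot_ge0_le0 bu0 (lecv_subr_le0 gDm).
  have := dot_ge0_le0 tl0 (lecv_subr_le0 s0).
  have := dot_ge0_le0 tu0 (lecv_subr_le0 sm).
  lra.
rewrite !mxE !sub0r !mulrN.
lra.
Qed.

End Lagrangian.

Theorem corollary1 (R : realFieldType) (M : model R)
    (x : decision M) (y : multipliers M)
    (hG : Gmin M = 0) (hx : optimal x) (hy : optimal_multipliers x y)
    (j : 'I_(ngen M)) :
  (cg M j 0 * gen x j 0 + cU M j 0 * rU x j 0 + cD M j 0 * rD x j 0
     <= price_g y j * gen x j 0 + price_U y j * rU x j 0
        + price_D y j * rD x j 0)
  /\ (forall s : option (scen M), bid_cost x s j <= credit x y s j).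
Proof.
suff H : cg M j 0 * gen x j 0 + cU M j 0 * rU x j 0 + cD M j 0 * rD x j 0
     <= price_g y j * gen x j 0 + price_U y j * rU x j 0
        + price_D y j * rD x j 0.
  by split=> // s; rewrite /bid_cost /credit lerD2r.
case: hx hy => feas _ [y0 dual].
have := dual (shift_gen x j (- gen x j 0) (- rU x j 0) (- rD x j 0)).
have := lagrangian_le_objective j feas y0.
rewrite lagrangian_shift_gen hG mxE.
case: feas => -[_ _ [Glo _] [rU0 _] [rD0 _]] _.
case: y0 => _ [_ uu0] [_ Uu0] [_ Du0] _.
have := Glo j; have := rU0 j; have := rD0 j.
have := uu0 j; have := Uu0 j; have := Du0 j.
rewrite hG !mxE add0r => Du Uu uu rD_ge0 rU_ge0 rD_le_g.
(* Adding the two Lagrangian bounds cancels every lower-bound multiplier: credit minus cost is at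
   least the sum of these four products. Here g(j) is nonnegative because 0 <= r_D(j) <= g(j). *)
have := mulr_ge0 uu (le_trans rD_ge0 rD_le_g).
have := mulr_ge0 uu rU_ge0.
have := mulr_ge0 Uu rU_ge0.
have := mulr_ge0 Du rD_ge0.
lra.
Qed.
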